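(* Let $\mathbf{X}\in\mathbb{R}^{n\times p}$ be deterministic, $\beta^*\in\mathbb{R}^p$, and $y=\mathbf{X}\beta^*+\varepsilon$ with $\varepsilon\sim N(0,\sigma^2I_{n\times n})$, $\sigma>0$. Let $\lambda\ge0$, $h(\beta)=\sqrt n\,\lambda\|\beta\|_1$ and $\hat\beta\in\operatorname*{argmin}_{\beta\in\mathbb{R}^p}\|\mathbf{X}\beta-y\|^2+2h(\beta)$. Let $d\ge1$ be an integer with $5d\le p$. If the tuning parameter satisfies $$\lambda\ \le\ \frac{1-\delta_{2d}}{8}\,\sigma\sqrt{\log(p/(5d))},$$ then $$\frac{1-\delta_{2d}}{8(1+\delta_d)}\,\sigma\sqrt{d\log(p/(5d))}\ \le\ \mathbb{E}\,\|\mathbf{X}(\hat\beta-\beta^* )\|.$$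
   Context: $\|\cdot\|$ is the Euclidean norm, $\|\cdot\|_1$ the $\ell_1$-norm, and $|\beta|_0$ the number of nonzero components of $\beta$. For $s\in\{1,\dots,p\}$, $\delta_s\ge0$ is the smallest $\delta\ge0$ such that $$(1-\delta)\|\beta\|\le\tfrac1{\sqrt n}\|\mathbf{X}\beta\|\le(1+\delta)\|\beta\|\qquad\text{for all }\beta\in\mathbb{R}^p\text{ with }|\beta|_0\le s.$$ *)

(* Defs.v *)
From HB Require Import structures.
From mathcomp Require Import all_boot all_order all_algebra.
From mathcomp Require Import all_classical all_reals all_analysis.

Set Implicit Arguments.
Unset Strict Implicit.
Unset Printing Implicit Defensive.

Import Order.TTheory GRing.Theory Num.Theory.
Import numFieldNormedType.Exports.

Local Open Scope classical_set_scope.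
Local Open Scope ring_scope.

(* The library norm `|v| on matrices is the sup norm, hence these two. *)
Definition l2norm (R : realType) (m : nat) (v : 'cV[R]_m) : R :=
  Num.sqrt (\sum_(i < m) v i 0 ^+ 2).

Definition l1norm (R : realType) (m : nat) (v : 'cV[R]_m) : R :=
  \sum_(i < m) `|v i 0|.

Definition l0norm (R : realType) (m : nat) (v : 'cV[R]_m) : nat :=
  #|[set i : 'I_m | v i 0 != 0]%SET|.

Definition restricted_isometry (R : realType) (n p : nat)
    (X : 'M[R]_(n, p)) (s : nat) (delta : R) : Prop :=
  0 <= delta /\
  forall b : 'cV[R]_p, (l0norm b <= s)%N ->
    (1 - delta) * l2norm b <= (Num.sqrt n%:R)^-1 * l2norm (X *m b)
      <= (1 + delta) * l2norm b.

(* The infimum is attained, see [ric_is_min]. *)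
Definition ric (R : realType) (n p : nat) (X : 'M[R]_(n, p)) (s : nat) : R :=
  inf [set delta | restricted_isometry X s delta].

Definition argmin (R : realType) (T : Type) (f : T -> R) : set T :=
  [set x | forall y, f x <= f y].

(* N(0, sigma^2 I_m): the law of e is the m-fold product of N(0, sigma^2); it
   is determined by its values on measurable boxes.  The second parameter of
   [normal_prob] is the standard deviation. *)
Definition isotropic_gaussian (R : realType) (disp : measure_display)
    (T : measurableType disp) (P : probability T R) (m : nat)
    (e : T -> 'cV[R]_m) (sigma : R) : Prop :=
  (forall i : 'I_m, measurable_fun setT (fun w => e w i 0)) /\
  forall A : 'I_m -> set R, (forall i, measurable (A i)) ->
    P [set w | forall i, A i (e w i 0)] =
      (\prod_(i < m) normal_prob 0 sigma (A i))%E.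

Lemma l2norm_ge0 (R : realType) (m : nat) (v : 'cV[R]_m) : 0 <= l2norm v.
Proof. exact: sqrtr_ge0. Qed.

Lemma l2norm_mulmx_le (R : realType) (n p : nat) (X : 'M[R]_(n, p))
    (b : 'cV[R]_p) :
  l2norm (X *m b) <= l2norm (\col_i \sum_j `|X i j|) * l2norm b.
Proof.
have ss m (v : 'cV[R]_m) : 0 <= \sum_(i < m) v i 0 ^+ 2.
  by apply: sumr_ge0 => i _; exact: sqr_ge0.
have bj j : `|b j 0| <= l2norm b.
  rewrite -sqrtr_sqr ler_wsqrtr// (bigD1 j)//= lerDl.
  by apply: sumr_ge0 => i _; exact: sqr_ge0.
rewrite -sqrtrM// ler_wsqrtr// mulr_suml ler_sum// => i _.
rewrite !mxE -(sqr_sqrtr (ss _ b)) -exprMn -[leLHS]real_normK ?num_real//.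
rewrite ler_sqr ?nnegrE//; last first.
  by rewrite mulr_ge0 ?l2norm_ge0// sumr_ge0.
rewrite (le_trans (ler_norm_sum _ _ _))// mulr_suml ler_sum// => j _.
by rewrite normrM ler_wpM2l.
Qed.

Lemma ric_is_min (R : realType) (n p : nat) (X : 'M[R]_(n, p)) (s : nat) :
  restricted_isometry X s (ric X s) /\
  forall delta, restricted_isometry X s delta -> ric X s <= delta.
Proof.
set S := [set delta | restricted_isometry X s delta].
have lbS : has_lbound S by exists 0 => d [].
pose C := l2norm (\col_i \sum_j `|X i j|).
have n0 : 0 <= (Num.sqrt n%:R)^-1 :> R by rewrite invr_ge0 sqrtr_ge0.
have S0 : S !=set0.
  have C0 : 0 <= (Num.sqrt n%:R)^-1 * C by rewrite mulr_ge0// l2norm_ge0.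
  exists (1 + (Num.sqrt n%:R)^-1 * C); split; first by rewrite addr_ge0.
  move=> b _; apply/andP; split.
    rewrite opprD addrA subrr add0r mulNr (@le_trans _ _ 0)//.
      by rewrite oppr_le0 mulr_ge0// l2norm_ge0.
    by rewrite mulr_ge0// l2norm_ge0.
  apply: (@le_trans _ _ ((Num.sqrt n%:R)^-1 * C * l2norm b)).
    by rewrite -mulrA ler_wpM2l// l2norm_mulmx_le.
  by rewrite ler_wpM2r ?l2norm_ge0// addrA lerDr addr_ge0.
have min_ric d : S d -> ric X s <= d by move=> Sd; exact: ge_inf.
split=> //; split; first by apply: lb_le_inf => // d [].
move=> b bs; set r := _ * l2norm (X *m b).
have := l2norm_ge0 b; rewrite le_eqVlt => /predU1P[b0|b0].
  have [d [d0 /(_ b bs)]] := S0; rewrite -/r -b0 !mulr0 => H.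
  exact: H.
apply/andP; split.
  rewrite -ler_pdivlMr// lerBlDr -lerBlDl.
  apply: lb_le_inf => // d [_ /(_ b bs)/andP[+ _]].
  by rewrite -/r -ler_pdivlMr// lerBlDr -lerBlDl.
rewrite -ler_pdivrMr// -lerBlDl.
apply: lb_le_inf => // d [_ /(_ b bs)/andP[_]].
by rewrite -/r -ler_pdivrMr// -lerBlDl.
Qed.

(* Main.v *)
Require Import Defs.
From HB Require Import structures.
From mathcomp Require Import all_boot all_order all_algebra.
From mathcomp Require Import all_classical all_reals all_analysis.
From mathcomp Require Import measurable_realfun ring lra zify.

(* By optimality of the Lasso, [<eps, X u> - h u <= |X (beta_hat - beta_star)|]
   for every direction [u] with [|X u| <= 1].  Cut [d * q] of the columns of
   [X], [q = p %/ d >= 5], into [d] blocks of size [q], and let [u] be the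
   normalised indicator of one column per block, chosen to maximise
   [<eps, X_j>] within its block.  Then [h u] is a constant, and it remains to
   bound from below, for each block, the expected maximum of the [q] Gaussian
   variables [<eps, X_j>], whose columns [X_j] are at mutual distance at least
   [sqrt (2 n) (1 - delta_2d)].

   This is Sudakov's minoration, obtained here with the constant [1 / sqrt 8]
   and without Slepian's lemma.  Let [x_i = <eps, v_i>] for [i] ranging over
   [N] indices, with the [v_i] at mutual distance at least [a], let [p_i] be
   the softmax weights of [t x_i] and [S = sum p_i^2].  Gaussian integration by
   parts gives
   [E max x_i >= E sum p_i x_i = (t sigma^2 / 2) E sum p_i p_j |v_i - v_j|^2
   >= (t sigma^2 a^2 / 2) E (1 - S)], while Gibbs' inequality gives
   [E (1 - S) ln N >= ln N - ln 2 - t E max x_i]; then optimise over [t]. *)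

Set Implicit Arguments.
Unset Strict Implicit.
Unset Printing Implicit Defensive.

Import Order.TTheory GRing.Theory Num.Theory.
Import numFieldNormedType.Exports.

Local Open Scope classical_set_scope.
Local Open Scope ring_scope.

(** * Integration by parts for the normal distribution *)

Section normal_integral.
Context {R : realType}.
Variable sigma : R.
Local Notation mu := (@lebesgue_measure R).
Local Notation N := (normal_prob (0 : R) sigma).
Local Notation pdf := (normal_pdf (0 : R) sigma).

(** [pdf] and the Radon-Nikodym derivative of [N] have the same integral on every measurable set,
    hence agree almost everywhere. *)
Lemma ge0_integral_normal_prob (f : R -> \bar R) : measurable_fun setT f ->
    (forall x, 0 <= f x)%E ->
  (\int[N]_x f x = \int[mu]_x (f x * (pdf x)%:E))%E.
Proof.
move=> mf f0.
have dom := normal_prob_dominates (0 : R) sigma.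
rewrite -(Radon_Nikodym_SigmaFinite.change_of_variables dom)//.
have mg := measurable_int _ (Radon_Nikodym_SigmaFinite.f_integrable dom).
have mp : measurable_fun setT (EFin \o pdf).
  by apply/measurable_EFinP; exact: measurable_normal_pdf.
apply: ae_eq_integral => //.
- exact: emeasurable_funM.
- exact: emeasurable_funM.
- apply: ae_eqe_mul2l; apply: integral_ae_eq => //.
  + exact: Radon_Nikodym_SigmaFinite.f_integrable.
  + by move=> E _ mE; rewrite -Radon_Nikodym_SigmaFinite.f_integral.
Qed.

Lemma integrable_normal_prob (f : R -> \bar R) : measurable_fun setT f ->
    mu.-integrable setT (fun x => f x * (pdf x)%:E)%E ->
  N.-integrable setT f.
Proof.
move=> mf /integrableP[_ fi]; apply/integrableP; split => //.
rewrite ge0_integral_normal_prob//; last exact: measurableT_comp.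
apply: le_lt_trans fi; rewrite le_eqVlt; apply/orP; left; apply/eqP.
apply: eq_integral => x _.
by rewrite abseM (gee0_abs (_ : (0 <= (pdf x)%:E)%E))// lee_fin normal_pdf_ge0.
Qed.

Lemma integral_normal_prob (f : R -> \bar R) : measurable_fun setT f ->
    mu.-integrable setT (fun x => f x * (pdf x)%:E)%E ->
  (\int[N]_x f x = \int[mu]_x (f x * (pdf x)%:E))%E.
Proof.
move=> mf fi.
rewrite integralE [RHS]integralE !ge0_integral_normal_prob//; last 2 first.
- exact: measurable_funeneg.
- exact: measurable_funepos.
congr (_ - _)%E; apply: eq_integral => x _.
- rewrite !funeposE maxe_pMl ?lee_fin ?normal_pdf_ge0//.
  by rewrite mul0e.
- rewrite !funenegE maxe_pMl ?lee_fin ?normal_pdf_ge0//.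
  by rewrite mul0e mulNe.
Qed.

End normal_integral.

Section stein.
Context {R : realType}.
Local Notation mu := (@lebesgue_measure R).

(** The fundamental theorem of calculus on [[-n, n]], then dominated convergence with dominating
    function [|f|]. *)
Lemma integral_derivable_vanishing (F f : R -> R) :
    (forall x, is_derive x (1 : R) F (f x)) -> continuous f ->
    mu.-integrable setT (EFin \o f) ->
    F n%:R @[n --> \oo] --> 0 -> F (- n%:R) @[n --> \oo] --> 0 ->
  (\int[mu]_x (f x)%:E = 0)%E.
Proof.
move=> dF cf fi F0 F0'.
pose A n : set R := `[- n%:R, n%:R]%classic.
pose g n x := ((f \_ (A n)) x)%:E.
have mf : measurable_fun setT f by exact: continuous_measurable_fun.
have mg n : measurable_fun setT (g n).
  apply/measurable_EFinP; apply: (measurable_restrictT f _).1.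
    exact: measurable_itv.
  exact: measurable_funTS.
have cvgI : (\int[mu]_x (g n x))%E @[n --> \oo] --> (\int[mu]_x (f x)%:E)%E.
  have [//||_ _ +] := @dominated_convergence _ _ _ mu setT measurableT g
    (EFin \o f) (abse \o (EFin \o f)) mg (measurable_int _ fi) _ (integrable_abse fi).
  - apply: aeW => x _; apply: cvg_near_cst; near=> n.
    rewrite /g patchE mem_set// /A /= in_itv/= -ler_norml.
    by near: n; exact: nbhs_infty_ger.
  - apply: aeW => x n _; rewrite /g patchE; case: ifPn => //= _.
    by rewrite normr0 lee_fin.
  - by [].
have cF x : {for x, continuous F}.
  by apply: differentiable_continuous; apply/derivable1_diffP; exact: ex_derive.
(* The index is shifted to [n.+1] so that the interval is nondegenerate. *)
have E n : (\int[mu]_x (g n.+1 x) = (F n.+1%:R - F (- n.+1%:R))%:E)%E.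
  transitivity (\int[mu]_(x in A n.+1) (f x)%:E)%E.
    rewrite [RHS]integral_mkcond; apply: eq_integral => x _.
    by rewrite /g !patchE; case: ifPn.
  apply: continuous_FTC2.
  - by rewrite gtrN// ltr0n.
  - exact: continuous_subspaceT.
  - split => [x _||].
    + exact: ex_derive.
    + exact/cvg_at_right_filter/cF.
    + exact/cvg_at_left_filter/cF.
  - by move=> x _; rewrite derive1E derive_val.
suff : (\int[mu]_x (g n x))%E @[n --> \oo] --> 0%E by exact: cvg_unique.
rewrite -(cvg_shiftS (fun n => \int[mu]_x (g n x))%E)/=.
under eq_cvg do rewrite E.
apply: cvg_EFin; first exact: nearW.
rewrite -(subr0 0); apply: cvgB.
- by rewrite (cvg_shiftS (fun n => F n%:R)).
- by rewrite (cvg_shiftS (fun n => F (- n%:R))).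
Unshelve. all: by end_near. Qed.
Context (sigma : R) (sigma_gt0 : 0 < sigma).
Local Notation N := (normal_prob (0 : R) sigma).
Local Notation pdf := (normal_pdf (0 : R) sigma).

Let pdfE x : pdf x = normal_peak sigma * expR (- x ^+ 2 / (sigma ^+ 2 *+ 2)).
Proof. by rewrite normal_pdfE ?gt_eqF// /normal_fun subr0. Qed.

Lemma is_derive_normal_pdf x :
  is_derive x (1 : R) pdf (- (x / sigma ^+ 2) * pdf x).
Proof.
have -> : pdf = (fun x => normal_peak sigma * expR (- x ^+ 2 / (sigma ^+ 2 *+ 2))).
  by apply/funext => y; exact: pdfE.
have d1 : is_derive x (1 : R) (fun y : R => - y ^+ 2 / (sigma ^+ 2 *+ 2)) (- (x / sigma ^+ 2)).
  have -> : (fun y : R => - y ^+ 2 / (sigma ^+ 2 *+ 2)) =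
      (- (sigma ^+ 2 *+ 2)^-1) *: (fun y : R => y ^+ 2).
    by apply/funext => y; rewrite !fctE /GRing.scale/= mulNr mulrC mulNr.
  apply: is_derive_eq.
  rewrite /GRing.scale/=.
  have s0 : sigma != 0 by rewrite gt_eqF.
  by field.
have d2 := @is_derive1_comp _ expR _ x _ _ (is_derive_expR _) d1.
have d3 := @is_deriveZ _ _ _ _ (normal_peak sigma) x 1 _ d2.
apply: is_derive_eq.
by rewrite /GRing.scale/=; ring.
Qed.

(** Half of the Gaussian exponent pays for the factor [x]: with [y = x^2 / (4 sigma^2)], the density
    is a multiple of [exp (-2y)], while [|x| <= 1 + x^2 <= (1 + 4 sigma^2) exp y], and the remaining
    [exp (-y)] is proportional to the normal density of standard deviation [tau = sqrt 2 sigma]. *)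
Lemma integrable_normal_pdfM : 
  mu.-integrable setT (fun x => (x * pdf x)%:E).
Proof.
pose tau := Num.sqrt 2 * sigma.
have tau_gt0 : 0 < tau by rewrite mulr_gt0// sqrtr_gt0.
pose C := (1 + 4 * sigma ^+ 2) * (normal_peak sigma / normal_peak tau).
have := integrableZl measurableT C (integrable_normal_pdf 0 tau).
apply: le_integrable => //.
  apply/measurable_EFinP; apply: measurable_funM => //.
  exact: measurable_normal_pdf.
move=> x _ /=; rewrite lee_fin [in leRHS]ger0_norm; last first.
  rewrite mulr_ge0 ?normal_pdf_ge0// mulr_ge0// ?divr_ge0 ?normal_peak_ge0//.
  by rewrite addr_ge0// mulr_ge0// sqr_ge0.
rewrite normrM (ger0_norm (normal_pdf_ge0 _ _ _)) pdfE.
rewrite normal_pdfE ?gt_eqF// /normal_fun subr0 /C.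
have pk : normal_peak tau != 0 by rewrite gt_eqF// normal_peak_gt0 ?gt_eqF.
rewrite -!mulrA (mulrA (_ tau)^-1) mulVf// mul1r mulrCA.
rewrite [leRHS]mulrCA ler_wpM2l ?normal_peak_ge0//.
set y := x ^+ 2 / (4 * sigma ^+ 2).
have -> : - x ^+ 2 / (sigma ^+ 2 *+ 2) = - y - y.
  rewrite /y; have s0 : sigma != 0 by rewrite gt_eqF.
  by field.
have -> : - x ^+ 2 / (tau ^+ 2 *+ 2) = - y.
  rewrite /y /tau exprMn sqr_sqrtr//; have s0 : sigma != 0 by rewrite gt_eqF.
  by field.
rewrite expRD mulrA ler_wpM2r ?expR_ge0//.
rewrite expRN ler_pdivrMr ?expR_gt0//.
have y0 : 0 <= y by rewrite divr_ge0 ?sqr_ge0// mulr_ge0// sqr_ge0.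
have s2 : 0 < sigma ^+ 2 by rewrite exprn_gt0.
have xy : x ^+ 2 = 4 * sigma ^+ 2 * y.
  by rewrite /y mulrC divfK// gt_eqF// mulr_gt0.
apply: (@le_trans _ _ (1 + x ^+ 2)).
  rewrite -real_normK ?num_real//; have := normr_ge0 x.
  by move: `|x| => z z0; have := sqr_ge0 (z - 1); nra.
rewrite xy; apply: (@le_trans _ _ ((1 + 4 * sigma ^+ 2) * (1 + y))); first by nra.
by rewrite ler_wpM2l ?expR_ge1Dx// addr_ge0// mulr_ge0// sqr_ge0.
Qed.

Lemma integrable_normal_id : N.-integrable setT (fun x => x%:E).
Proof.
apply: integrable_normal_prob; first exact/measurable_EFinP.
exact: integrable_normal_pdfM.
Qed.

Lemma cvg_normal_pdf : pdf n%:R @[n --> \oo] --> 0.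
Proof.
pose q := expR (- (sigma ^+ 2 *+ 2)^-1).
have q1 : `|q| < 1.
  by rewrite ger0_norm ?expR_ge0// expR_lt1 oppr_lt0 invr_gt0 pmulrn_lgt0// exprn_gt0.
(* Since [n <= n^2], the Gaussian tail lies below a geometric one. *)
have ub n : pdf n%:R <= normal_peak sigma * q ^+ n.
  rewrite pdfE ler_wpM2l ?normal_peak_ge0// /q -expRM_natl ler_expR.
  rewrite mulNr mulrN lerN2 -natrX ler_wpM2r ?invr_ge0 ?pmulrn_lge0 ?sqr_ge0//.
  by rewrite ler_nat; case: n => // n; rewrite expnS leq_pmulr// expn_gt0.
apply: (@squeeze_cvgr _ _ _ _ (cst 0) (fun n => normal_peak sigma * q ^+ n)).
- by apply: nearW => n; rewrite normal_pdf_ge0/= ub.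
- exact: cvg_cst.
- rewrite -[X in _ --> X](mulr0 (normal_peak sigma)).
  by apply: cvgM; [exact: cvg_cst|exact: cvg_expr].
Qed.

Let cvg_bounded_pdf (F : R -> R) (B : R) (a : nat -> R) :
    (forall x, `|F x| <= B) -> (forall n, pdf (a n) = pdf n%:R) ->
  F (a n) * pdf (a n) @[n --> \oo] --> 0.
Proof.
move=> FB aE; apply/norm_cvg0P.
apply: (@squeeze_cvgr _ _ _ _ (cst 0) (fun n => B * pdf n%:R)).
- apply: nearW => n; rewrite normr_ge0/= normrM aE.
  by rewrite (ger0_norm (normal_pdf_ge0 _ _ _)) ler_wpM2r ?normal_pdf_ge0.
- exact: cvg_cst.
- rewrite -[X in _ --> X](mulr0 B).
  by apply: cvgM; [exact: cvg_cst|exact: cvg_normal_pdf].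
Qed.

(** Stein's identity: [F * pdf] vanishes at infinity and has derivative
    [f * pdf - x * F * pdf / sigma^2], whose integral is therefore zero. *)
Lemma stein_normal (F f : R -> R) (B : R) :
    (forall x, is_derive x (1 : R) F (f x)) -> continuous f ->
    (forall x, `|F x| <= B) -> (forall x, `|f x| <= B) ->
  (\int[N]_x (x * F x)%:E = (sigma ^+ 2)%:E * \int[N]_x (f x)%:E)%E.
Proof.
move=> dF cf FB fB.
have mf : measurable_fun setT f by exact: continuous_measurable_fun.
have cF : continuous F.
  move=> x; apply: differentiable_continuous; apply/derivable1_diffP.
  exact: ex_derive.
have mF : measurable_fun setT F by exact: continuous_measurable_fun.
have mp := measurable_normal_pdf (0 : R) sigma.
have s2 : sigma ^+ 2 != 0 by rewrite gt_eqF// exprn_gt0.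
have i1 : mu.-integrable setT (fun x => (x * F x * pdf x)%:E).
  have := integrableZl measurableT B integrable_normal_pdfM.
  apply: le_integrable => //.
    by apply/measurable_EFinP; apply: measurable_funM => //; exact: measurable_funM.
  move=> x _ /=; rewrite lee_fin !normrM mulrAC mulrC ler_wpM2r//.
  by rewrite (le_trans (FB x)) ?ler_norm.
have i2 : mu.-integrable setT (fun x => (f x * pdf x)%:E).
  have := integrableZl measurableT B (integrable_normal_pdf 0 sigma).
  apply: le_integrable => //.
    by apply/measurable_EFinP; apply: measurable_funM.
  move=> x _ /=; rewrite lee_fin !normrM ler_wpM2r//.
  by rewrite (le_trans (fB x)) ?ler_norm.
rewrite !integral_normal_prob//; last 2 first.
- exact/measurable_EFinP.
- by apply/measurable_EFinP; exact: measurable_funM.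
have i3 := integrableZl measurableT (sigma ^+ 2)^-1 i1.
pose g x := f x * pdf x - (sigma ^+ 2)^-1 * (x * F x * pdf x).
have ig : (\int[mu]_x (g x)%:E = 0)%E.
  apply: (@integral_derivable_vanishing (fun x => F x * pdf x)).
  - move=> x; have dp := is_derive_normal_pdf x.
    have dFp := @is_deriveM _ _ F pdf x 1 _ _ (dF x) dp.
    by apply: is_derive_eq; rewrite /g /GRing.scale/=; ring.
  - have cp : continuous pdf by apply: continuous_normal_pdf; rewrite gt_eqF.
    move=> x; apply: cvgB; first by apply: cvgM; [exact: cf|exact: cp].
    apply: cvgM; first exact: cvg_cst.
    by apply: cvgM; [apply: cvgM; [exact: cvg_id|exact: cF]|exact: cp].
  - rewrite [X in _.-integrable _ X](_ : _ = (fun x => (f x * pdf x)%:E) \-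
        (fun x => ((sigma ^+ 2)^-1)%:E * (x * F x * pdf x)%:E))%E//.
    by apply: integrableB => //; exact: i3.
  - exact: (cvg_bounded_pdf FB).
  - by apply: (cvg_bounded_pdf FB) => n; rewrite !pdfE sqrrN.
have := integralB measurableT i2 i3.
rewrite (integralZl measurableT i1) [X in X = _](_ : _ = 0%E) => [|]; last by rewrite -ig.
move=> uv; suff: (\int[mu]_x (x * F x * pdf x)%:E =
  (sigma ^+ 2)%:E * \int[mu]_x (f x * pdf x)%:E)%E by [].
move: uv.
have := integrable_fin_num measurableT i1.
have := integrable_fin_num measurableT i2.
move: (integral _ _ _) => u; move: (integral _ _ _) => v.
move: u v => [u| |] [v| |]// _ _.
rewrite -!EFinM -EFinB => -[/esym uv]; congr EFin.
have -> : u = (sigma ^+ 2)^-1 * v by apply/eqP; rewrite -subr_eq0 uv.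
by rewrite mulrA divff// mul1r.
Qed.

End stein.

(** * Integration by parts for an isotropic Gaussian vector *)

Lemma integrable_bounded {R : realType} {d} {T : measurableType d}
    (mu : {finite_measure set T -> \bar R}) (f : T -> R) (B : R) :
    measurable_fun setT f -> (forall x, `|f x| <= B) ->
  mu.-integrable setT (EFin \o f).
Proof.
move=> mf fB; apply: (@le_integrable _ _ _ _ _ measurableT _ (cst B%:E)).
- exact/measurable_EFinP.
- by move=> x _ /=; rewrite lee_fin (le_trans (fB x))// ler_norm.
- exact: finite_measure_integrable_cst.
Qed.

Section isotropic_gaussian_theory.
Context {R : realType} {disp : measure_display} {T : measurableType disp}.
Context (P : probability T R) (m : nat) (e : T -> 'cV[R]_m) (sigma : R).
Hypothesis sigma_gt0 : 0 < sigma.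
Hypothesis gauss_e : isotropic_gaussian P e sigma.
Local Notation N := (normal_prob (0 : R) sigma).

Lemma measurable_coord i : measurable_fun setT (fun w => e w i 0).
Proof. exact: gauss_e.1. Qed.

Section other_coordinates.
Variable k : 'I_m.

Definition other_boxes : set (set T) :=
  [set B | exists2 A : 'I_m -> set R, (forall i, measurable (A i)) &
     B = [set w | forall i, i != k -> A i (e w i 0)]].

(* The sample space with the sigma-algebra generated by the coordinates other
   than [k], so that [w |-> (e w k 0, w)] has a product law on
   [R * other_space]. *)
Definition other_space := g_sigma_algebraType other_boxes.

(** The identity, seen as a map into the coarser sigma-algebra. *)
Definition to_other (w : T) : other_space := w.

Lemma other_boxes_measurable : other_boxes `<=` measurable.
Proof.
move=> _ [A mA ->].
rewrite [X in measurable X](_ : _ =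
  \bigcap_(i in [set i | i != k]) ((fun w => e w i 0) @^-1` A i)).
  apply: fin_bigcap_measurable; first exact: finite_finset.
  move=> i _; rewrite -[X in measurable X]setTI.
  exact: measurable_coord.
by apply/seteqP; split.
Qed.

Lemma other_measurable (B : set T) : <<s other_boxes >> B -> measurable B.
Proof.
apply: smallest_sub; last exact: other_boxes_measurable.
exact: sigma_algebra_measurable.
Qed.

Lemma measurable_to_other : measurable_fun setT to_other.
Proof.
by move=> _ B mB; rewrite setTI; exact: other_measurable.
Qed.

Lemma measurable_other_coord i : i != k ->
  measurable_fun setT (fun w : other_space => e w i 0).
Proof.
move=> ik _ A mA; rewrite setTI; apply: sub_sigma_algebra.
exists (fun j => if j == i then A else setT) => [j|]; first by case: ifP.
apply/seteqP; split => w /=.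
  by move=> Aw j jk; case: eqP => // ->.
by move=> /(_ i ik); rewrite eqxx.
Qed.

Let Pcoord (A : set R) (C : 'I_m -> set R) : measurable A ->
    (forall i, measurable (C i)) ->
  P ((fun w => e w k 0) @^-1` A `&` [set w | forall i, i != k -> C i (e w i 0)]) =
  (N A * \prod_(i < m | i != k) N (C i))%E.
Proof.
move=> mA mC; pose D i := if i == k then A else C i.
have mD i : measurable (D i) by rewrite /D; case: ifP.
transitivity (P [set w | forall i, D i (e w i 0)]).
  congr (P _); apply/seteqP; split => w /=.
    by move=> [Aw Cw] i; rewrite /D; case: eqP => [->//|/eqP]; exact: Cw.
  move=> Dw; split; first by have := Dw k; rewrite /D eqxx.
  by move=> i ik; have := Dw i; rewrite /D (negbTE ik).
rewrite gauss_e.2// (bigD1 k)//=; congr (_ * _)%E; first by rewrite /D eqxx.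
by apply: eq_bigr => i ik; rewrite /D (negbTE ik).
Qed.

Lemma coord_distribution (A : set R) : measurable A ->
  P ((fun w => e w k 0) @^-1` A) = N A.
Proof.
move=> mA; have := @Pcoord A (fun=> setT) mA (fun=> measurableT).
rewrite big1 ?mule1 => [<-|i _]; last exact: probability_setT.
by congr (P _); apply/seteqP; split => w //= [].
Qed.

(** Dynkin's pi-lambda argument in [B]: the boxes are stable under intersection and satisfy the
    product formula, which passes to complements and to countable disjoint unions. *)
Lemma coord_independent_other (A : set R) (B : set T) : measurable A ->
    <<s other_boxes >> B ->
  P ((fun w => e w k 0) @^-1` A `&` B) = (N A * P B)%E.
Proof.
move=> mA; set E := _ @^-1` A.
have mE : measurable E by rewrite -[E]setTI; exact: measurable_coord.
have PE : P E = N A by exact: coord_distribution.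
apply: (@dynkin_induction _ other_space other_boxes
  (fun B => P (E `&` B) = (N A * P B)%E)) => //.
- move=> _ _ [A1 mA1 ->] [A2 mA2 ->]; exists (fun i => A1 i `&` A2 i).
    by move=> i; exact: measurableI.
  apply/seteqP; split => w /=; first by move=> [? ?] i ik; split; auto.
  by move=> H; split => i /H[].
- by rewrite setIT probability_setT mule1.
- move=> _ [C mC ->]; rewrite (Pcoord mA mC).
  have := @Pcoord setT C measurableT mC.
  by rewrite preimage_setT setTI probability_setT mul1e => ->.
- move=> S mS PS; have mS' : @measurable _ T S by exact: other_measurable.
  rewrite -setDE measureD//; last by rewrite -ge0_fin_numE// fin_num_measure.
  rewrite [X in (_ - X)%E]PS probability_setC// muleBr ?fin_num_measure//.
  by rewrite mule1 [X in (X - _)%E]PE.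
- move=> F mF tF PF; have mF' n : @measurable _ T (F n) by exact: other_measurable (mF n).
  rewrite setI_bigcupr measure_bigcup//; last 2 first.
  + by move=> n _; exact: measurableI.
  + exact: trivIset_setIl.
  rewrite measure_bigcup//.
  have NAfin : N A \is a fin_num by exact: fin_num_measure.
  rewrite -(fineK NAfin) -nneseriesZl//; apply: eq_eseriesr => n _.
  by rewrite fineK//; exact: PF.
Qed.

Definition split_coord (w : T) : measurableTypeR R * other_space := (e w k 0, w).

Lemma measurable_split_coord : measurable_fun setT split_coord.
Proof.
apply: measurable_fun_pair; first exact: measurable_coord.
exact: measurable_to_other.
Qed.

HB.instance Definition _ := @isMeasurableFun.Build _ _ T
  (measurableTypeR R * other_space)%type split_coord measurable_split_coord.

HB.instance Definition _ := @isMeasurableFun.Build _ _ T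
  other_space to_other measurable_to_other.


Local Notation split_rv :=
  (split_coord : {mfun T >-> (measurableTypeR R * other_space)%type}).
Local Notation other_rv := (to_other : {mfun T >-> other_space}).
(** By independence both measures agree on rectangles, which determine a product measure. *)
Lemma split_coord_distribution (A : set (measurableTypeR R * other_space)) :
    measurable A ->
  (N \x distribution P other_rv)%E A = distribution P split_rv A.
Proof.
apply: product_measure_unique => B C mB mC.
by rewrite -coord_independent_other.
Qed.

Lemma integrable_coord : P.-integrable setT (fun w => (e w k 0)%:E).
Proof.
have := integrable_normal_id sigma_gt0.
move=> /integrableP[_ Nfin]; apply/integrableP; split.
  by apply/measurable_EFinP; exact: measurable_coord.
apply: le_lt_trans Nfin; rewrite le_eqVlt; apply/orP; left; apply/eqP.
rewrite (@eq_measure_integral _ _ _ _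
  (pushforward P ((fun w => e w k 0) : T -> measurableTypeR R))).
- exact: measurable_coord.
- move=> mk; rewrite ge0_integral_pushforward//.
  by apply: measurableT_comp => //; exact: measurable_EFin.
- by move=> mk A mA _; rewrite [RHS]coord_distribution.
Qed.

Lemma integrable_split (h : R * other_space -> \bar R) :
    @measurable_fun _ _ (measurableTypeR R * other_space)%type _ setT h ->
    P.-integrable setT (h \o split_coord) ->
  (N \x distribution P other_rv)%E.-integrable setT h.
Proof.
move=> mh /integrableP[_ hfin]; apply/integrableP; split => //.
rewrite (eq_measure_integral (distribution P split_rv)); last first.
  by move=> A mA _; exact: split_coord_distribution.
by rewrite ge0_integral_distribution//; exact: measurableT_comp.
Qed.

Lemma integral_split (h : R * other_space -> \bar R) :
    @measurable_fun _ _ (measurableTypeR R * other_space)%type _ setT h ->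
    P.-integrable setT (h \o split_coord) ->
  (\int[P]_w h (split_coord w) =
   \int[distribution P other_rv]_v \int[N]_x h (x, v))%E.
Proof.
move=> mh hfin; rewrite (integral21_prod_meas1 (integrable_split mh hfin)).
rewrite (eq_measure_integral (distribution P split_rv)); last first.
  by move=> A mA _; exact: split_coord_distribution.
by rewrite integral_distribution.
Qed.

(** By Fubini the other coordinates are frozen and [stein_normal] is applied to coordinate [k].
    Measurability over [other_space] expresses that [F] and [f] depend on their second argument only
    through the coordinates other than [k]. *)
Lemma stein_gaussian (F f : R -> T -> R) (B : R) :
    @measurable_fun _ _ (measurableTypeR R * other_space)%type R setT
      (fun z => F z.1 z.2) ->
    @measurable_fun _ _ (measurableTypeR R * other_space)%type R setT
      (fun z => f z.1 z.2) ->
    (forall w x, is_derive x (1 : R) (F^~ w) (f x w)) ->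
    (forall w, continuous (f^~ w)) ->
    (forall x w, `|F x w| <= B) -> (forall x w, `|f x w| <= B) ->
  (\int[P]_w (e w k 0 * F (e w k 0) w)%:E =
   (sigma ^+ 2)%:E * \int[P]_w (f (e w k 0) w)%:E)%E.
Proof.
move=> mF mf dF cf FB fB.
have mF1 : measurable_fun setT (fun w => F (e w k 0) w).
  exact: (measurableT_comp mF measurable_split_coord).
have mf1 : measurable_fun setT (fun w => f (e w k 0) w).
  exact: (measurableT_comp mf measurable_split_coord).
rewrite (@integral_split (fun z => (z.1 * F z.1 z.2)%:E)); last 2 first.
- by apply/measurable_EFinP; apply: measurable_funM.
- have := integrableZl measurableT B integrable_coord; apply: le_integrable => //.
    apply/measurable_EFinP; apply: measurable_funM => //; exact: measurable_coord.
  move=> w _ /=; rewrite lee_fin !normrM mulrC ler_wpM2r//.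
  by rewrite (le_trans (FB _ _)) ?ler_norm.
have fi : P.-integrable setT (EFin \o (fun w => f (e w k 0) w)).
  by apply: (@integrable_bounded _ _ _ _ _ B) => // w; exact: fB.
rewrite -integralZl// (@integral_split (fun z => (sigma ^+ 2)%:E * (f z.1 z.2)%:E)%E).
- apply: eq_integral => w _; rewrite (stein_normal sigma_gt0 (dF w) (cf w) (FB^~ w))//.
  rewrite integralZl//; apply: (@integrable_bounded _ _ _ N _ B).
    by have := continuous_measurable_fun (cf w).
  by move=> x; exact: fB.
- by apply: measurable_funeM; exact/measurable_EFinP.
- exact: integrableZl.
Qed.

End other_coordinates.
End isotropic_gaussian_theory.

(** * Softmax weights *)

Definition softmax {R : realType} {N : nat} (z : 'I_N -> R) (i : 'I_N) : R :=
  expR (z i) / \sum_j expR (z j).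

(** Convexity of the exponential. The bounds [1 + x <= exp x] at [x = -pL] and [x = (1-p)L],
    averaged with weights [1-p] and [p], have left-hand side 1; multiplying by [exp (pL)]
    concludes. *)
Lemma expR_chord {R : realType} (p L : R) : 0 <= p <= 1 ->
  expR (p * L) <= 1 + p * (expR L - 1).
Proof.
move=> /andP[p0 p1].
have h1 := expR_ge1Dx (- (p * L)); have h2 := expR_ge1Dx ((1 - p) * L).
have e1 : expR (p * L) * expR (- (p * L)) = 1 by rewrite -expRD subrr expR0.
have e2 : expR (p * L) * expR ((1 - p) * L) = expR L.
  by rewrite -expRD; congr expR; ring.
have h : 1 <= (1 - p) * expR (- (p * L)) + p * expR ((1 - p) * L) by nra.
rewrite -[leLHS]mulr1 (le_trans (ler_wpM2l (expR_ge0 _) h))//.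
rewrite mulrDr mulrCA e1 mulrCA e2; lra.
Qed.

Section softmax_theory.
Context {R : realType} {N : nat}.
Implicit Types (z : 'I_N -> R) (i : 'I_N).

Lemma sum_expR_gt0 z i : 0 < \sum_j expR (z j).
Proof.
rewrite (bigD1 i)//= ltr_pwDl ?expR_gt0//.
by apply: sumr_ge0 => j _; exact: expR_ge0.
Qed.

Lemma softmax_gt0 z i : 0 < softmax z i.
Proof. by rewrite divr_gt0 ?expR_gt0// (sum_expR_gt0 z i). Qed.

Lemma sum_softmax z : (0 < N)%N -> \sum_i softmax z i = 1.
Proof.
move=> N0; rewrite -mulr_suml divff//.
by rewrite gt_eqF// (sum_expR_gt0 z (Ordinal N0)).
Qed.

Lemma softmax_le1 z i : softmax z i <= 1.
Proof.
rewrite ler_pdivrMr ?(sum_expR_gt0 z i)// mul1r (bigD1 i)//= lerDl.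
by apply: sumr_ge0 => j _; exact: expR_ge0.
Qed.

Lemma ln_softmax z i : ln (softmax z i) = z i - ln (\sum_j expR (z j)).
Proof. by rewrite ln_div ?posrE ?expR_gt0 ?(sum_expR_gt0 z i)// expRK. Qed.

(* Gibbs' variational inequality for the softmax weights [p_i], tested against
   the subprobability [r_i = N^(p_i) / (2 N)]. *)
Lemma softmax_entropy z : (0 < N)%N ->
  N%:R^-1 * (\sum_i z i) - \sum_i softmax z i * z i <=
    ln 2 - (\sum_i softmax z i ^+ 2) * ln N%:R.
Proof.
move=> N0; pose p := softmax z; pose Z := \sum_j expR (z j).
have N0' : (0 : R) < N%:R by rewrite ltr0n.
have Z0 : 0 < Z by exact: (sum_expR_gt0 z (Ordinal N0)).
have p01 i : 0 <= p i <= 1 by rewrite ltW ?softmax_gt0//= softmax_le1.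
(* Jensen's inequality for the logarithm, from [1 + x <= exp x] at [x = ln N + z_i - ln Z], where
   [exp x = N p_i] sums to [N]. *)
have lnZ : ln N%:R + N%:R^-1 * (\sum_i z i) <= ln Z.
  have h : \sum_i (1 + (ln N%:R + z i - ln Z)) <= \sum_i (N%:R * p i).
    apply: ler_sum => i _; apply: le_trans (expR_ge1Dx _) _.
    rewrite expRD expRN expRD !lnK ?posrE//.
    by rewrite /p /softmax -/Z mulrA.
  move: h; rewrite -mulr_sumr sum_softmax// big_split/= sumr_const card_ord.
  rewrite mulr1 gerDl big_split/= big_split/= !sumr_const card_ord => h.
  rewrite -subr_le0 -(pmulr_rle0 _ N0') (le_trans _ h)// le_eqVlt.
  apply/orP; left; apply/eqP; rewrite mulrBr mulrDr mulrA divff ?gt_eqF// mul1r.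
  by rewrite !mulr_natl mulNrn.
(* This is [1 + ln (r_i / p_i) <= r_i / p_i] multiplied by [p_i]; [expR_chord] then bounds [N^(p_i)]
   by [1 + p_i (N - 1)], so that the right-hand sides sum to at most 1. *)
have gibbs : \sum_i (p i * (1 + (p i * ln N%:R - ln 2 - ln N%:R - (z i - ln Z))))
    <= \sum_i (2 * N%:R)^-1 * (1 + p i * (N%:R - 1)).
  apply: ler_sum => i _; apply: le_trans (ler_wpM2l _ (expR_ge1Dx _)) _.
    by rewrite ltW// softmax_gt0.
  rewrite -ln_softmax -/p expRD expRN lnK ?posrE ?softmax_gt0//.
  rewrite mulrCA divff ?gt_eqF ?softmax_gt0// mulr1.
  rewrite 2!expRD !expRN !lnK ?posrE// -mulrA -invfM mulrC ler_wpM2l//.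
  by rewrite (le_trans (expR_chord _ (p01 i)))// lnK ?posrE.
have r1 : \sum_i (2 * N%:R)^-1 * (1 + p i * (N%:R - 1)) <= 1.
  rewrite -mulr_sumr big_split/= sumr_const card_ord -mulr_suml sum_softmax//.
  rewrite ler_pdivrMl ?mulr_gt0// mul1r mulr1; lra.
have := le_trans gibbs r1.
have -> : \sum_i (p i * (1 + (p i * ln N%:R - ln 2 - ln N%:R - (z i - ln Z)))) =
   1 + (\sum_i p i ^+ 2) * ln N%:R - ln 2 - ln N%:R - \sum_i p i * z i + ln Z.
  transitivity (\sum_i (p i * (1 - ln 2 - ln N%:R + ln Z) + p i ^+ 2 * ln N%:R
     - p i * z i)).
    by apply: eq_bigr => i _; ring.
  have sp : \sum_i p i = 1 by exact: sum_softmax.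
  rewrite big_split/= big_split/= sumrN -mulr_suml sp mul1r -mulr_suml; ring.
by rewrite -/p; lra.
Qed.

End softmax_theory.

Section softmax_derive.
Context {R : realType} {N : nat} (N_gt0 : (0 < N)%N).
Variables (b c r : 'I_N -> R).
Let z (x : R) (j : 'I_N) := c j * x + r j.

Definition softmax_mean (x : R) : R := \sum_i b i * softmax (z x) i.

(** The covariance of [b] and [c] under the softmax weights: the derivative of the mean of [b] when
    the exponents move with slopes [c]. *)
Definition softmax_cov (x : R) : R :=
  \sum_i b i * c i * softmax (z x) i -
  (\sum_i b i * softmax (z x) i) * (\sum_i c i * softmax (z x) i).

Lemma is_derive_softmax_mean x :
  is_derive x (1 : R) softmax_mean (softmax_cov x).
Proof.
have dE j : is_derive x (1 : R) (fun y => expR (z y j)) (c j * expR (z x j)).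
  have d1 : is_derive x (1 : R) (z^~ j) (c j).
    rewrite (_ : z^~ j = (c j *: id) + cst (r j)); last first.
      by apply/funext => y; rewrite !fctE.
    by apply: is_derive_eq; rewrite addr0 /GRing.scale/= mulr1.
  have := @is_derive1_comp _ expR _ x _ _ (is_derive_expR _) d1.
  by move=> d2; apply: is_derive_eq; exact: mulrC.
have dZ := @is_derive_sum _ _ _ _ _ x 1 _ dE.
have dA := @is_derive_sum _ _ _ _ _ x 1 _ (fun i =>
  @is_deriveZ _ _ _ _ (b i) x 1 _ (dE i)).
have Z0 : (\sum_(i < N) (fun y => expR (z y i))) x != 0.
  by rewrite fct_sumE gt_eqF// (sum_expR_gt0 (z x) (Ordinal N_gt0)).
have dV := @is_deriveV _ _ _ _ _ Z0 dZ.
have dG := @is_deriveM _ _ _ _ x 1 _ _ dA dV.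
rewrite (_ : softmax_mean = (\sum_(i < N) (b i *: (fun y => expR (z y i))))
  * (fun y => ((\sum_(i < N) (fun y => expR (z y i))) y)^-1)); last first.
  apply/funext => y; rewrite fctE !fct_sumE mulr_suml; apply: eq_bigr => i _.
  by rewrite /softmax mulrA.
apply: is_derive_eq.
rewrite !fct_sumE /GRing.scale/= /softmax_cov.
set Z := \sum_i expR (z x i).
have Z_neq0 : Z != 0 by rewrite gt_eqF// (sum_expR_gt0 (z x) (Ordinal N_gt0)).
have smE (u : 'I_N -> R) :
    \sum_i u i * softmax (z x) i = (\sum_i u i * expR (z x i)) / Z.
  by rewrite mulr_suml; apply: eq_bigr => i _; rewrite mulrA.
rewrite !smE.
rewrite (_ : \sum_i b i * (c i * expR (z x i)) = \sum_i b i * c i * expR (z x i)).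
  by field.
by apply: eq_bigr => i _; rewrite mulrA.
Qed.

Lemma continuous_softmax_mean : continuous softmax_mean.
Proof.
move=> x; apply: differentiable_continuous; apply/derivable1_diffP.
by have [] := is_derive_softmax_mean x.
Qed.

End softmax_derive.

Section softmax_bounds.
Context {R : realType} {N : nat} (N_gt0 : (0 < N)%N).

Lemma norm_sum_softmax (b z : 'I_N -> R) :
  `|\sum_i b i * softmax z i| <= \sum_i `|b i|.
Proof.
rewrite (le_trans (ler_norm_sum _ _ _))// ler_sum// => i _.
rewrite normrM (ger0_norm (ltW (softmax_gt0 _ _))).
by rewrite ler_piMr// softmax_le1.
Qed.

Lemma continuous_softmax_cov (b c r : 'I_N -> R) : continuous (softmax_cov b c r).
Proof.
move=> x; have h := @continuous_softmax_mean R N N_gt0.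
have -> : softmax_cov b c r = softmax_mean (fun i => b i * c i) c r -
    softmax_mean b c r * softmax_mean c c r by [].
exact: (cvgB (h (fun i => b i * c i) c r x) (cvgM (h b c r x) (h c c r x))).
Qed.

Lemma norm_softmax_cov (b c r : 'I_N -> R) x :
  `|softmax_cov b c r x| <=
  \sum_i `|b i * c i| + (\sum_i `|b i|) * (\sum_i `|c i|).
Proof.
rewrite (le_trans (ler_normB _ _))// lerD//; first exact: norm_sum_softmax.
by rewrite normrM ler_pM// norm_sum_softmax.
Qed.

Lemma measurable_softmax d (T : measurableType d) (z : T -> 'I_N -> R) i :
    (forall j, measurable_fun setT (z^~ j)) ->
  measurable_fun setT (fun w => softmax (z w) i).
Proof.
move=> mz.
(* Written as an exponential, the quotient becomes a composition of measurable functions. *)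
rewrite (_ : (fun w => _) = fun w => expR (z w i - ln (\sum_j expR (z w j)))).
  apply: measurableT_comp => //; apply: measurable_funB => //.
  apply: measurableT_comp => //; apply: measurable_sum => j.
  exact: measurableT_comp.
by apply/funext => w; rewrite -ln_softmax lnK// posrE softmax_gt0.
Qed.

End softmax_bounds.

(** * Sudakov's minoration *)

(** A variance is half the mean squared difference of two independent draws; the square is
    expanded. *)
Lemma variance_pairs {R : realFieldType} {N : nat} (p u : 'I_N -> R) :
    \sum_i p i = 1 ->
  \sum_i u i ^+ 2 * p i - (\sum_i u i * p i) ^+ 2 =
  2^-1 * \sum_i \sum_j p i * p j * (u i - u j) ^+ 2.
Proof.
move=> p1.
have -> : \sum_i \sum_j p i * p j * (u i - u j) ^+ 2 =
    \sum_i \sum_j (u i ^+ 2 * p i * p j) + \sum_i \sum_j (p i * (u j ^+ 2 * p j))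
    - 2 * \sum_i \sum_j (u i * p i * (u j * p j)).
  rewrite mulr_sumr -sumrN -!big_split/=; apply: eq_bigr => i _.
  by rewrite mulr_sumr -sumrN -!big_split/=; apply: eq_bigr => j _; ring.
have -> : \sum_i \sum_j (u i * p i * (u j * p j)) = (\sum_i u i * p i) ^+ 2.
  by rewrite expr2 mulr_suml; apply: eq_bigr => i _; rewrite mulr_sumr.
have -> : \sum_i \sum_j (u i ^+ 2 * p i * p j) = \sum_i u i ^+ 2 * p i.
  by apply: eq_bigr => i _; rewrite -mulr_sumr p1 mulr1.
have -> : \sum_i \sum_j (p i * (u j ^+ 2 * p j)) = \sum_i u i ^+ 2 * p i.
  by under eq_bigr do rewrite -mulr_sumr; rewrite -mulr_suml p1 mul1r.
by field.
Qed.

(** For two independent draws from [p], the pairs [i != j] have total mass [1 - sum p_i^2], and the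
    diagonal contributes a nonnegative amount. *)
Lemma pairs_ge {R : realFieldType} {N : nat} (p : 'I_N -> R)
    (D : 'I_N -> 'I_N -> R) (b : R) :
    (forall i, 0 <= p i) -> \sum_i p i = 1 -> (forall i, 0 <= D i i) ->
    (forall i j, i != j -> b <= D i j) ->
  b * (1 - \sum_i p i ^+ 2) <= \sum_i \sum_j p i * p j * D i j.
Proof.
move=> p0 p1 D0 bD.
have -> : b * (1 - \sum_i p i ^+ 2) = \sum_i \sum_(j | j != i) p i * p j * b.
  rewrite -{1}p1 -sumrB mulr_sumr; apply: eq_bigr => i _.
  rewrite -mulr_suml -mulr_sumr.
  have -> : \sum_(j | j != i) p j = 1 - p i.
    by have := p1; rewrite (bigD1 i)//=; lra.
  by rewrite mulrC; ring.
apply: ler_sum => i _; rewrite [leRHS](bigD1 i)//= ler_wpDl//.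
  by rewrite !mulr_ge0.
by apply: ler_sum => j ji; rewrite ler_wpM2l ?mulr_ge0// bD// eq_sym.
Qed.

Section sudakov.
Context {R : realType} {disp : measure_display} {T : measurableType disp}.
Context (P : probability T R) (m : nat) (e : T -> 'cV[R]_m) (sigma : R).
Hypothesis sigma_gt0 : 0 < sigma.
Hypothesis gauss_e : isotropic_gaussian P e sigma.

(** Stein's identity with [F = 1] and [f = 0]. *)
Lemma integral_coord k : (\int[P]_w (e w k (0 : 'I_1))%:E = 0)%E.
Proof.
have H := @stein_gaussian R disp T P m e sigma sigma_gt0 gauss_e k
  (fun=> cst 1) (fun=> cst 0) 1.
transitivity (\int[P]_w (e w k (0 : 'I_1) * 1)%:E)%E.
  by apply: eq_integral => w _; rewrite mulr1.
rewrite H//; last by move=> *; rewrite normr0.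
  by rewrite integral0 mule0.
by move=> w x; exact: cvg_cst.
by move=> *; rewrite normr1.
Qed.

Context {N : nat} (N_gt0 : (0 < N)%N) (v : 'I_N -> 'cV[R]_m).

Definition gauss_proc i w : R := \sum_k v i k 0 * e w k 0.

Lemma measurable_gauss_proc i : measurable_fun setT (gauss_proc i).
Proof.
apply: measurable_sum => k; apply: measurable_funM => //.
exact: (measurable_coord gauss_e).
Qed.

Lemma integrable_gauss_proc i : P.-integrable setT (EFin \o gauss_proc i).
Proof.
rewrite (_ : _ \o _ = fun w => (\sum_k (v i k 0)%:E * (e w k (0:'I_1))%:E)%E).
  apply: integrable_sum => // k _; apply: integrableZl => //.
  exact: (integrable_coord sigma_gt0 gauss_e).
by apply/funext => w; rewrite /= -sumEFin.
Qed.

Lemma integral_gauss_proc i : (\int[P]_w (gauss_proc i w)%:E = 0)%E.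
Proof.
rewrite (_ : (fun w => _) = fun w => (\sum_k (v i k 0)%:E * (e w k (0:'I_1))%:E)%E).
  rewrite integral_sum//.
    rewrite big1// => k _; rewrite integralZl ?integral_coord ?mule0//.
    exact: (integrable_coord sigma_gt0 gauss_e).
  by move=> k; apply: integrableZl => //; exact: (integrable_coord sigma_gt0 gauss_e).
by apply/funext => w; rewrite /= -sumEFin.
Qed.


Let weight (t : R) (w : T) := softmax (fun j => t * gauss_proc j w).

Let measurable_weight t i : measurable_fun setT (weight t ^~ i).
Proof.
apply: measurable_softmax => j; apply: measurable_funM => //.
exact: measurable_gauss_proc.
Qed.

Let integrable_weight_sqr t :
  P.-integrable setT (EFin \o (fun w => 1 - \sum_i weight t w i ^+ 2)).
Proof.
apply: (@integrable_bounded _ _ _ _ _ 1).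
  apply: measurable_funB => //; apply: measurable_sum => i.
  apply: measurable_funX; exact: measurable_weight.
move=> w; rewrite ger0_norm ?gerBl ?subr_ge0//; first last.
  rewrite -(sum_softmax (fun j => t * gauss_proc j w) N_gt0) ler_sum// => i _.
  by rewrite expr2 ler_piMl ?softmax_le1// ltW// softmax_gt0.
by apply: sumr_ge0 => i _; exact: sqr_ge0.
Qed.

(** This is [softmax_cov] for [b_i = v_ik] and [c_i = t v_ik]: the derivative, in noise coordinate
    [k], of the softmax mean of the [v_ik]. *)
Let cov (t : R) (k : 'I_m) (w : T) :=
  \sum_i v i k 0 * (t * v i k 0) * weight t w i -
  (\sum_i v i k 0 * weight t w i) * (\sum_i (t * v i k 0) * weight t w i).

Let bound (t : R) (k : 'I_m) :=
  (\sum_i `|v i k 0 * (t * v i k 0)| +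
   (\sum_i `|v i k 0|) * (\sum_i `|t * v i k 0|)).

Let measurable_cov t k : measurable_fun setT (cov t k).
Proof.
by apply: measurable_funB; [|apply: measurable_funM]; apply: measurable_sum => i;
  exact: measurable_funM.
Qed.

Let integrable_cov t k : P.-integrable setT (EFin \o cov t k).
Proof.
apply: (@integrable_bounded _ _ _ _ _ (bound t k)) => // w.
rewrite (le_trans (ler_normB _ _))// lerD//; first exact: norm_sum_softmax.
by rewrite normrM ler_pM// norm_sum_softmax.
Qed.

(** With the other coordinates frozen, the exponents [t x_j] are affine in [e_k], with slope [c j]
    and intercept [r w j], so [stein_gaussian] applies to the softmax mean of the [v_ik]. *)
Let stein_weight t k :
  (\int[P]_w (e w k 0 * \sum_i v i k 0 * weight t w i)%R%:E =
   (sigma ^+ 2)%:E * \int[P]_w (cov t k w)%:E)%E.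
Proof.
pose b i := v i k 0; pose c i := t * v i k 0.
pose r w i := t * \sum_l if l != k then v i l 0 * e w l 0 else 0.
have zE w : (fun j => c j * e w k 0 + r w j) = fun j => t * gauss_proc j w.
  apply/funext => j.
  by rewrite /gauss_proc (bigD1 k)//= mulrDr mulrA /r -big_mkcond.
have mz j : @measurable_fun _ _ (measurableTypeR R * other_space e k)%type R setT
    (fun z => c j * z.1 + r z.2 j).
  apply: measurable_funD; first exact: measurable_funM.
  apply: measurable_funM => //; apply: measurable_sum => l.
  have [_|lk] := eqVneq l k; first exact: measurable_cst.
  apply: measurable_funM => //.
  exact: (measurableT_comp (@measurable_other_coord R disp T m e k l lk) measurable_snd).
have mb i : @measurable_fun _ _ (measurableTypeR R * other_space e k)%type R setT
    (fun z => softmax (fun j => c j * z.1 + r z.2 j) i).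
  exact: measurable_softmax.
(* One bound must serve the function and its derivative; the sum of their two bounds does. *)
have H := @stein_gaussian R disp T P m e sigma sigma_gt0 gauss_e k
  (fun x w => softmax_mean b c (r w) x) (fun x w => softmax_cov b c (r w) x)
  (\sum_i `|b i| + bound t k).
have b0 : 0 <= \sum_i `|b i| by exact: sumr_ge0.
have B0 : 0 <= bound t k.
  by apply: addr_ge0; rewrite ?mulr_ge0// sumr_ge0.
transitivity (\int[P]_w (e w k (0 : 'I_1) * softmax_mean b c (r w) (e w k 0))%:E)%E.
  by apply: eq_integral => w _; rewrite /softmax_mean zE.
apply: (etrans (H _ _ _ _ _ _)); last first.
- apply: (congr1 (fun x => (sigma ^+ 2)%:E * x)%E); apply: eq_integral => w _.
  by rewrite /softmax_cov zE.
- by move=> x w; rewrite (le_trans (norm_softmax_cov _ _ _ _))// lerDr.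
- by move=> x w; rewrite (le_trans (norm_sum_softmax _ _))// lerDl.
- by move=> w; exact: continuous_softmax_cov.
- by move=> w x; exact: is_derive_softmax_mean.
- by apply: measurable_funB; [|apply: measurable_funM];
    apply: measurable_sum => i; exact: measurable_funM.
- by apply: measurable_sum => i; exact: measurable_funM.
Qed.

Context (a : R) (sep : forall i j, i != j -> a <= l2norm (v i - v j)).
Hypothesis a_ge0 : 0 <= a.

(** Each [cov t k] is [t] times the softmax variance of coordinate [k]. By [variance_pairs], summing
    over [k] assembles the squared distances [|v_i - v_j|^2], which are at least [a^2] off the
    diagonal. *)
Let sum_cov_ge t w : 0 <= t ->
  t * a ^+ 2 / 2 * (1 - \sum_i weight t w i ^+ 2) <= \sum_k cov t k w.
Proof.
move=> t0; pose p := weight t w.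
have p1 : \sum_i p i = 1 by exact: sum_softmax.
have p0 i : 0 <= p i by rewrite ltW// softmax_gt0.
have -> : \sum_k cov t k w =
    t / 2 * \sum_i \sum_j p i * p j * l2norm (v i - v j) ^+ 2.
  transitivity (\sum_k t * (\sum_i v i k 0 ^+ 2 * p i - (\sum_i v i k 0 * p i) ^+ 2)).
    apply: eq_bigr => k _; rewrite /cov -/p.
    have -> : \sum_i v i k 0 * (t * v i k 0) * p i = t * \sum_i v i k 0 ^+ 2 * p i.
      by rewrite mulr_sumr; apply: eq_bigr => i _; ring.
    have -> : \sum_i t * v i k 0 * p i = t * \sum_i v i k 0 * p i.
      by rewrite mulr_sumr; apply: eq_bigr => i _; ring.
    by ring.
  under eq_bigr do rewrite (variance_pairs _ p1) mulrA.
  rewrite -mulr_sumr; congr (_ * _).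
  rewrite exchange_big/=; apply: eq_bigr => i _.
  rewrite exchange_big/=; apply: eq_bigr => j _.
  rewrite -mulr_sumr /l2norm sqr_sqrtr; last first.
    by apply: sumr_ge0 => k _; exact: sqr_ge0.
  by congr (_ * _); apply: eq_bigr => k _; rewrite !mxE.
have -> : t * a ^+ 2 / 2 * (1 - \sum_i p i ^+ 2) =
  t / 2 * (a ^+ 2 * (1 - \sum_i p i ^+ 2)) by ring.
rewrite ler_wpM2l ?divr_ge0//; apply: pairs_ge => //.
  by move=> i; exact: sqr_ge0.
by move=> i j ij; rewrite ler_sqr ?nnegrE ?l2norm_ge0// sep.
Qed.

Context (M : T -> R) (iM : P.-integrable setT (EFin \o M)).
Hypothesis MX : forall i w, gauss_proc i w <= M w.

Let mean_weight_le t w : \sum_i weight t w i * gauss_proc i w <= M w.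
Proof.
rewrite -[leRHS]mul1r -(sum_softmax (fun j => t * gauss_proc j w) N_gt0).
rewrite mulr_suml ler_sum// => i _.
by rewrite ler_wpM2l// ltW// softmax_gt0.
Qed.

(** The weighted mean of the [x_i] is at most [M]; regrouped by noise coordinate it is
    [sum_k e_k sum_i v_ik p_i], and [stein_weight] turns its expectation into [sigma^2] times that
    of [sum_k cov t k]. *)
Let gap_bound t : 0 <= t ->
  ((sigma ^+ 2 * (t * a ^+ 2 / 2))%:E *
   \int[P]_w (1 - \sum_i weight t w i ^+ 2)%:E <= \int[P]_w (M w)%:E)%E.
Proof.
move=> t0.
have iSe k : P.-integrable setT
    (fun w => (e w k (0:'I_1) * \sum_i v i k 0 * weight t w i)%:E).
  have := integrableZl measurableT (\sum_i `|v i k 0|)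
    (integrable_coord sigma_gt0 gauss_e k).
  apply: le_integrable => //.
    apply/measurable_EFinP; apply: measurable_funM.
      exact: (measurable_coord gauss_e).
    by apply: measurable_sum => i; exact: measurable_funM.
  move=> w _ /=; rewrite lee_fin !normrM mulrC ler_wpM2r//.
  by rewrite (le_trans (norm_sum_softmax _ _))// ler_norm.
have sE w : (\sum_i weight t w i * gauss_proc i w)%:E =
    (\sum_k (e w k (0:'I_1) * \sum_i v i k 0 * weight t w i)%:E)%E.
  rewrite sumEFin; congr EFin.
  under [RHS]eq_bigr do rewrite mulr_sumr.
  rewrite exchange_big/=; apply: eq_bigr => i _.
  by rewrite /gauss_proc mulr_sumr; apply: eq_bigr => k _; ring.
apply: (@le_trans _ _ (\int[P]_w (\sum_i weight t w i * gauss_proc i w)%:E)%E); last first.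
  apply: le_integral => //; last by move=> w _; rewrite lee_fin mean_weight_le.
  under eq_fun do rewrite sE; exact: integrable_sum.
under [leRHS]eq_integral do rewrite sE.
rewrite integral_sum//; under [leRHS]eq_bigr do rewrite stein_weight.
have icov k : P.-integrable setT (fun w => (sigma ^+ 2)%:E * (cov t k w)%:E)%E.
  by apply: integrableZl => //; exact: integrable_cov.
have -> : (\sum_k (sigma ^+ 2)%:E * \int[P]_w (cov t k w)%:E =
    \int[P]_w (\sum_k (sigma ^+ 2)%:E * (cov t k w)%:E)%E)%E.
  rewrite integral_sum//; apply: eq_bigr => k _.
  by rewrite integralZl//; exact: integrable_cov.
rewrite -(integralZl measurableT (integrable_weight_sqr t)).
apply: le_integral => //.
- by apply: integrableZl => //; exact: integrable_weight_sqr.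
- exact: integrable_sum.
- move=> w _; rewrite -EFinM sumEFin lee_fin -mulr_sumr -[leLHS]mulrA.
  by rewrite ler_wpM2l ?sqr_ge0// sum_cov_ge.
Qed.

(** [softmax_entropy] at [z_i = t x_i], integrated: the plain average of the [x_i] has mean zero,
    and their weighted mean is at most [M]. *)
Let entropy_bound t : 0 <= t ->
  ((ln N%:R - ln 2)%:E - t%:E * \int[P]_w (M w)%:E <=
   (ln N%:R)%:E * \int[P]_w (1 - \sum_i weight t w i ^+ 2)%:E)%E.
Proof.
move=> t0.
have iX i : P.-integrable setT (fun w => (N%:R^-1 * t)%:E * (gauss_proc i w)%:E)%E.
  by apply: integrableZl => //; exact: integrable_gauss_proc.
have iL : P.-integrable setT (fun=> (ln N%:R - ln 2)%:E).
  exact: (@finite_measure_integrable_cst _ _ _ P).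
have itM : P.-integrable setT (fun w => t%:E * (M w)%:E)%E by exact: integrableZl.
have intX : (\int[P]_w (\sum_i (N%:R^-1 * t)%:E * (gauss_proc i w)%:E)%E = 0)%E.
  rewrite integral_sum// big1// => i _.
  by rewrite integralZl ?integral_gauss_proc ?mule0//; exact: integrable_gauss_proc.
have intL : (\int[P]_w (ln N%:R - ln 2)%:E = (ln N%:R - ln 2)%:E)%E.
  by have := expectation_cst P (ln N%:R - ln 2 : R); rewrite unlock.
rewrite -[X in (X - _)%E]intL -(integralZl measurableT iM).
rewrite -(integralB measurableT iL itM) -[leLHS]adde0 -intX.
rewrite -integralD//; last 2 first.
- exact: integrableB.
- exact: integrable_sum.
rewrite -(integralZl measurableT (integrable_weight_sqr t)).
apply: le_integral => //.
- by apply: integrableD => //; [exact: integrableB|exact: integrable_sum].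
- by apply: integrableZl => //; exact: integrable_weight_sqr.
- move=> w _.
  rewrite -!EFinM sumEFin -EFinB -EFinD lee_fin -mulr_sumr.
  have := @softmax_entropy R N (fun j => t * gauss_proc j w) N_gt0.
  rewrite -!mulr_sumr mulrA.
  have -> : \sum_i softmax (fun j => t * gauss_proc j w) i * (t * gauss_proc i w)
      = t * \sum_i weight t w i * gauss_proc i w.
    by rewrite mulr_sumr; apply: eq_bigr => i _; rewrite /weight; ring.
  have := ler_wpM2l t0 (mean_weight_le t w).
  rewrite -/(weight t w); lra.
Qed.

Lemma sudakov_minoration :
  ((sigma * a / Num.sqrt 8 * Num.sqrt (ln (N%:R / 4)))%:E <= \int[P]_w (M w)%:E)%E.
Proof.
have [mu muE] : exists mu : R, (\int[P]_w (M w)%:E = mu%:E)%E.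
  by exists (fine (\int[P]_w (M w)%:E)%E); rewrite fineK// integrable_fin_num.
have mu0 : 0 <= mu.
  suff : (0 <= \int[P]_w (M w)%:E)%E by rewrite muE lee_fin.
  rewrite -(integral_gauss_proc (Ordinal N_gt0)).
  apply: le_integral => //; first exact: integrable_gauss_proc.
  by move=> w _; rewrite lee_fin.
rewrite muE lee_fin.
(* For [N <= 4] the square root is 0 and the claim is [0 <= mu]. *)
have [lnN|K_gt0] := leP (ln (N%:R / 4 : R)) 0.
  by rewrite (ler0_sqrtr lnN) mulr0.
move: a_ge0; rewrite le_eqVlt => /predU1P[<-|a_gt0]; first by rewrite mulr0 !mul0r.
set K := ln (N%:R / 4) in K_gt0 *.
set L : R := ln N%:R; set l2 : R := ln 2.
have KE : K = L - l2 - l2.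
  rewrite /K /L /l2 (_ : 4 = 2 * 2 :> R); last by ring.
  by rewrite ln_div ?posrE ?ltr0n// lnM ?posrE// opprD addrA.
have l2_gt0 : 0 < l2 by rewrite ln_gt0// ltr1n.
set c := sigma * a / Num.sqrt 8 * Num.sqrt K.
have c_gt0 : 0 < c by rewrite !mulr_gt0 ?invr_gt0 ?sqrtr_gt0.
have c2 : c ^+ 2 = sigma ^+ 2 * a ^+ 2 * K / 8.
  rewrite /c !exprMn exprVn !sqr_sqrtr ?ltW//; ring.
rewrite leNgt; apply/negP => mu_lt.
(* Against the assumption [mu < c], this [t] makes [t c = L / 2]. The entropy bound then gives
   [L D >= L - ln 2 - L / 2 = K / 2], and the gap bound multiplied by [c] gives [c mu >= sigma^2 a^2
   L D / 4 >= sigma^2 a^2 K / 8 = c^2], a contradiction. *)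
pose t := L / (2 * c).
have L_gt0 : 0 < L by move: K_gt0; rewrite KE; lra.
have t_gt0 : 0 < t by rewrite divr_gt0// mulr_gt0.
have [D DE] : exists D : R, (\int[P]_w (1 - \sum_i weight t w i ^+ 2)%:E = D%:E)%E.
  exists (fine (\int[P]_w (1 - \sum_i weight t w i ^+ 2)%:E)%E).
  by rewrite fineK// (integrable_fin_num measurableT (integrable_weight_sqr t)).
have := gap_bound (ltW t_gt0); rewrite DE muE -EFinM lee_fin => gap.
have := entropy_bound (ltW t_gt0); rewrite DE muE -!EFinM -EFinB lee_fin => ent.
have tc : t * c = L / 2 by rewrite /t; field; rewrite gt_eqF.
have LD : K / 2 <= L * D.
  have : t * mu <= t * c by rewrite ler_wpM2l// ltW.
  by rewrite tc -/L -/l2 in ent *; lra.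
have : c * (sigma ^+ 2 * (t * a ^+ 2 / 2) * D) = sigma ^+ 2 * a ^+ 2 / 4 * (L * D).
  transitivity (sigma ^+ 2 * a ^+ 2 / 2 * (t * c) * D); first by ring.
  by rewrite tc; field.
have : sigma ^+ 2 * a ^+ 2 / 4 * (K / 2) <= sigma ^+ 2 * a ^+ 2 / 4 * (L * D).
  by rewrite ler_wpM2l// divr_ge0// mulr_ge0// sqr_ge0.
have : c * (sigma ^+ 2 * (t * a ^+ 2 / 2) * D) < c * c.
  by rewrite ltr_pM2l// (le_lt_trans gap).
rewrite -expr2 c2; lra.
Qed.

End sudakov.

(** * Optimality of the Lasso *)

Section euclidean.
Context {R : realType} {m : nat}.
Implicit Types u v : 'cV[R]_m.

Lemma l2norm_sqr u : l2norm u ^+ 2 = \sum_i u i 0 ^+ 2.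
Proof. by rewrite sqr_sqrtr// sumr_ge0// => i _; exact: sqr_ge0. Qed.

Lemma l2norm_eq0 u : l2norm u = 0 -> u = 0.
Proof.
move=> u0; have := l2norm_sqr u; rewrite u0 expr0n/= => /esym/eqP.
rewrite psumr_eq0 => [/allP H|i _]; last exact: sqr_ge0.
apply/colP => i; rewrite mxE; apply/eqP.
by have := H i (mem_index_enum _); rewrite sqrf_eq0.
Qed.

Lemma l2normZ (c : R) u : 0 <= c -> l2norm (c *: u) = c * l2norm u.
Proof.
move=> c0; rewrite /l2norm.
have -> : \sum_i (c *: u) i 0 ^+ 2 = c ^+ 2 * \sum_i u i 0 ^+ 2.
  by rewrite mulr_sumr; apply: eq_bigr => i _; rewrite mxE exprMn.
by rewrite sqrtrM ?sqr_ge0// sqrtr_sqr ger0_norm.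
Qed.

(** Cauchy-Schwarz against the unit ball: expand [0 <= |u - s v|^2] with [s = |u|] and divide by
    [s]. *)
Lemma dot_le_l2norm u v : l2norm v <= 1 -> \sum_i u i 0 * v i 0 <= l2norm u.
Proof.
move=> v1; have := l2norm_ge0 u; rewrite le_eqVlt => /predU1P[/esym u0|u_gt0].
  by rewrite u0 (l2norm_eq0 u0) big1// => i _; rewrite mxE mul0r.
have s2E := l2norm_sqr u; move: (l2norm u) u_gt0 s2E => s u_gt0 s2E.
have : 0 <= \sum_i (u i 0 - s * v i 0) ^+ 2.
  by apply: sumr_ge0 => i _; exact: sqr_ge0.
have -> : \sum_i (u i 0 - s * v i 0) ^+ 2 =
    s ^+ 2 - 2 * s * (\sum_i u i 0 * v i 0) + s ^+ 2 * l2norm v ^+ 2.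
  rewrite [in X in _ = X - _ + _]s2E l2norm_sqr !mulr_sumr -sumrN -!big_split/=.
  by apply: eq_bigr => i _; ring.
have : l2norm v ^+ 2 <= 1 by rewrite expr_le1// l2norm_ge0.
have : 0 < s ^+ 2 by rewrite exprn_gt0.
move=> s2 B1 H; have H1 := ler_wpM2l (ltW s2) B1.
by rewrite -(ler_pM2l u_gt0) -expr2; lra.
Qed.

Lemma l1norm_triangle u v (t : R) : 0 <= t ->
  l1norm (u + t *: v) <= l1norm u + t * l1norm v.
Proof.
move=> t0; rewrite /l1norm mulr_sumr -big_split/= ler_sum// => i _.
by rewrite !mxE (le_trans (ler_normD _ _))// normrM (ger0_norm t0).
Qed.

End euclidean.

Section lasso_dual.
Context {R : realType} {n p : nat} (X : 'M[R]_(n, p)) (y : 'cV[R]_n) (C : R).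
Hypothesis C_ge0 : 0 <= C.

(** First-order optimality in the direction [u]: comparing [bh] with [bh + t u] gives
    [2 (A - C |u|_1) <= t B] for every [t > 0], which for small [t] forces [A <= C |u|_1]. *)
Lemma lasso_dual_feasible (bh u : 'cV[R]_p) :
    argmin (fun b => l2norm (X *m b - y) ^+ 2 + 2 * (C * l1norm b)) bh ->
  \sum_i (y - X *m bh) i 0 * (X *m u) i 0 <= C * l1norm u.
Proof.
move=> bh_min; set A := \sum_i _.
set B := l2norm (X *m u) ^+ 2.
have B0 : 0 <= B by exact: sqr_ge0.
have key t : 0 < t -> 2 * (A - C * l1norm u) <= t * B.
  move=> t0; have := bh_min (bh + t *: u).
  have -> : l2norm (X *m (bh + t *: u) - y) ^+ 2 =
      l2norm (X *m bh - y) ^+ 2 - 2 * t * A + t ^+ 2 * B.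
    rewrite /B /A !l2norm_sqr !mulr_sumr -sumrN -!big_split/=.
    apply: eq_bigr => i _; rewrite mulmxDr -scalemxAr.
    move: (X *m bh) (X *m u) => r s; rewrite !mxE; ring.
  have := ler_wpM2l C_ge0 (l1norm_triangle bh u (ltW t0)).
  move: (l1norm u) (l1norm bh) (l1norm _) => a1 a2 a3.
  move: (l2norm _ ^+ 2) => q h1 h2.
  by rewrite -(ler_pM2l t0); nra.
rewrite -subr_le0 leNgt; apply/negP => gap.
(* For this [t] the product [t B] is smaller than the positive gap [A - C |u|_1]. *)
have := key ((A - C * l1norm u) / (B + 1)).
rewrite divr_gt0// ?ltr_wpDl// => /(_ isT).
rewrite mulrAC ler_pdivlMr ?ltr_wpDl//; nra.
Qed.

End lasso_dual.

(** * Sparse test vectors for the restricted isometry property *)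

Section indicator_vector.
Context {R : realType} {p : nat} (S : {set 'I_p}).

Definition indicator_col : 'cV[R]_p := \col_i (i \in S)%:R.

Lemma l0norm_indicator : l0norm indicator_col = #|S|.
Proof.
rewrite /l0norm; congr #|pred_of_set _|; apply/setP => i.
by rewrite !inE mxE pnatr_eq0 eqb0 negbK.
Qed.

Lemma l1norm_indicator : l1norm indicator_col = #|S|%:R.
Proof.
rewrite /l1norm -sum1_card natr_sum [RHS]big_mkcond/=; apply: eq_bigr => i _.
by rewrite mxE normr_nat; case: (i \in S).
Qed.

Lemma l2norm_indicator : l2norm indicator_col = Num.sqrt #|S|%:R.
Proof.
congr Num.sqrt; rewrite -sum1_card natr_sum [RHS]big_mkcond/=; apply: eq_bigr => i _.
by rewrite mxE; case: (i \in S); rewrite ?expr1n// expr0n.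
Qed.

Lemma mulmx_indicator (n : nat) (X : 'M[R]_(n, p)) i :
  (X *m indicator_col) i 0 = \sum_(j in S) X i j.
Proof.
rewrite mxE [RHS]big_mkcond/=; apply: eq_bigr => j _.
by rewrite mxE; case: (j \in S); rewrite ?mulr1 ?mulr0.
Qed.

End indicator_vector.

(** The test vector is the difference of two standard basis vectors: it is 2-sparse, has norm
    [sqrt 2], and [X] maps it to the difference of the two columns. *)
Lemma ric_col_dist {R : realType} (n p s : nat) (X : 'M[R]_(n, p)) (i j : 'I_p) :
    (0 < n)%N -> (2 <= s)%N -> i != j ->
  Num.sqrt n%:R * ((1 - ric X s) * Num.sqrt 2) <= l2norm (col i X - col j X).
Proof.
move=> n0 s2 ij; have [[_ H] _] := ric_is_min X s.
pose b : 'cV[R]_p := delta_mx i 0 - delta_mx j 0.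
have bE k : b k 0 = (k == i)%:R - (k == j)%:R by rewrite !mxE !eqxx !andbT.
have b0 : (l0norm b <= s)%N.
  apply: leq_trans s2; apply: (@leq_trans #|[set i; j]%SET|); last by rewrite cards2 ij.
  apply: subset_leq_card; apply/fintype.subsetP => k; rewrite !inE bE.
  by have [|_] := eqVneq k i; have [|_] := eqVneq k j => //=; rewrite subrr eqxx.
have b2 : l2norm b = Num.sqrt 2.
  congr Num.sqrt; rewrite (bigD1 i)//= (bigD1 j) 1?eq_sym//= big1; last first.
    by move=> k /andP[ki kj]; rewrite bE (negbTE ki) (negbTE kj) subrr expr0n.
  have /negbTE ji : j != i by rewrite eq_sym.
  by rewrite !bE !eqxx (negbTE ij) ji subr0 sub0r sqrrN expr1n addr0.
have /andP[+ _] := H b b0.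
rewrite ler_pdivlMl ?sqrtr_gt0 ?ltr0n// b2.
by rewrite mulmxBr !colE.
Qed.

(** Serves for the loss of an arbitrary selection [beta_hat], which need not be measurable. The
    integral of a nonnegative function is a supremum over the simple functions below it, hence
    monotone all the same, and dropping the negative part of [g] only increases its integral. *)
Lemma le_integral_nonmeasurable d (T : measurableType d) (R : realType)
    (mu : {measure set T -> \bar R}) (g f : T -> R) :
    mu.-integrable setT (EFin \o g) ->
    (forall x, 0 <= f x) -> (forall x, g x <= f x) ->
  (\int[mu]_x (g x)%:E <= \int[mu]_x (f x)%:E)%E.
Proof.
move=> ig f0 gf; rewrite integralE.
apply: (@le_trans _ _ (\int[mu]_x ((EFin \o g)^\+ x))%E).
  by rewrite -[leRHS]sube0; apply: leeB => //; exact: integral_ge0.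
rewrite !ge0_integralTE//.
apply: le_ereal_sup => _ /= [h hg <-]; exists h => // x.
by rewrite (le_trans (hg x))// funeposE ge_max lee_fin gf lee_fin f0.
Qed.

(** * Finite maxima of random variables *)

Section bigmax.
Context {R : realType} {N : nat} (i0 : 'I_N).

(** The default [f i0] of the big operator is itself one of the values. *)
Lemma bigmax_attained (f : 'I_N -> R) :
  exists i, \big[Num.max/f i0]_i f i = f i.
Proof.
apply: (@big_ind _ (fun x => exists i, x = f i)).
- by exists i0.
- by move=> _ _ [i ->] [j ->]; rewrite /Order.max; case: ifP; [exists j|exists i].
- by move=> i _; exists i.
Qed.

Context {d} {T : measurableType d} (f : 'I_N -> T -> R).

Lemma measurable_bigmax : (forall i, measurable_fun setT (f i)) ->
  measurable_fun setT (fun w => \big[Num.max/f i0 w]_i f i w).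
Proof.
move=> mf; elim: (index_enum _) => [|i s ih].
  by under eq_fun do rewrite big_nil; exact: mf.
by under eq_fun do rewrite big_cons; exact: measurable_maxr.
Qed.

(** Being the value of some [f i], the maximum is bounded in absolute value by the sum of the
    [|f i|]. *)
Lemma integrable_bigmax (mu : {measure set T -> \bar R}) :
    (forall i, mu.-integrable setT (EFin \o f i)) ->
  mu.-integrable setT (EFin \o (fun w => \big[Num.max/f i0 w]_i f i w)).
Proof.
move=> fi.
have : mu.-integrable setT (fun w => \sum_i (abse \o (EFin \o f i)) w)%E.
  by apply: integrable_sum => // i _; exact: integrable_abse.
apply: le_integrable => //.
  apply/measurable_EFinP; apply: measurable_bigmax => i.
  by apply/measurable_EFinP; exact: measurable_int (fi i).
move=> w _ /=; have [i ->] := bigmax_attained (f^~ w).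
rewrite sumEFin lee_fin ger0_norm ?sumr_ge0// (bigD1 i)//= lerDl.
by rewrite sumr_ge0.
Qed.

End bigmax.

(** * Block directions *)

Section blocks.
Variables (d p : nat).

Lemma block_subproof (k : 'I_d) (j : 'I_(p %/ d)) : (k * (p %/ d)%N + j < p)%N.
Proof.
apply: (@leq_trans (k.+1 * (p %/ d)%N)).
  by rewrite mulSn addnC ltn_add2r.
by rewrite (leq_trans (leq_mul (ltn_ord k) (leqnn _)))// mulnC leq_trunc_div.
Qed.

Definition block (k : 'I_d) (j : 'I_(p %/ d)) : 'I_p := Ordinal (block_subproof k j).

Lemma block_inj k k' j j' : block k j = block k' j' -> k = k' /\ j = j'.
Proof.
move=> /(congr1 val)/= E.
have q0 : (0 < p %/ d)%N by case: j {E} => j /=; case: (p %/ d)%N.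
have kk : k = k' :> nat.
  have := congr1 (divn ^~ (p %/ d)%N) E => /=.
  by rewrite !divnMDl// !divn_small// !addn0.
split; first exact: val_inj.
by apply: val_inj; move: E; rewrite kk => /addnI.
Qed.

End blocks.

Lemma card_block (d p : nat) (J : 'I_d -> 'I_(p %/ d)) :
  #|[set block k (J k) | k : 'I_d]%SET| = d.
Proof. by rewrite card_imset ?card_ord// => k k' /block_inj[]. Qed.

(** This is [p / (5 d) <= q / 4] without division, for [q = p %/ d]: indeed [p < (q + 1) d], and
    [4 (q + 1) <= 5 q] because [q >= 5]. *)
Lemma block_size_ge (d p : nat) : (0 < d)%N -> (5 * d <= p)%N ->
  (p * 4 <= (p %/ d)%N * (5 * d))%N.
Proof.
move=> d0 dp; have := ltn_ceil p d0.
have : (5 <= (p %/ d)%N)%N by rewrite leq_divRL.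
move: (p %/ d)%N => q; nia.
Qed.

(** * Lower bounds on the loss from test directions *)

Section noise_barrier.
Context {R : realType} {n p : nat} (X : 'M[R]_(n, p)) (C : R) (C_ge0 : 0 <= C).

(** The residual at [bh] is [e - X (bh - bs)]. Dual feasibility bounds its inner product with [X u]
    by [C |u|_1], and Cauchy-Schwarz bounds that of [X (bh - bs)] with [X u]. *)
Lemma noise_barrier (e : 'cV[R]_n) (bs bh u : 'cV[R]_p) :
    argmin (fun b => l2norm (X *m b - (X *m bs + e)) ^+ 2 + 2 * (C * l1norm b)) bh ->
    l2norm (X *m u) <= 1 ->
  \sum_i e i 0 * (X *m u) i 0 - C * l1norm u <= l2norm (X *m (bh - bs)).
Proof.
move=> /(lasso_dual_feasible C_ge0 u) feas Xu1.
have := dot_le_l2norm (X *m (bh - bs)) Xu1; apply: le_trans.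
rewrite lerBlDl -lerBlDr; apply: le_trans feas.
rewrite -sumrB le_eqVlt; apply/orP; left; apply/eqP; apply: eq_bigr => i _.
rewrite mulmxBr; move: (X *m bh) (X *m bs) (X *m u) => r s t; rewrite !mxE; ring.
Qed.

Context {d : nat} (d_gt0 : (0 < d)%N) (n_gt0 : (0 < n)%N).

(* [c] normalises the indicator [b] of one column per block so that
   [|X (c b)| <= 1]. *)
Lemma noise_barrier_blocks (e : 'cV[R]_n) (bs bh : 'cV[R]_p)
    (J : 'I_d -> 'I_(p %/ d)) (c : R) :
    c = (Num.sqrt n%:R * Num.sqrt d%:R * (1 + ric X d))^-1 ->
    argmin (fun b => l2norm (X *m b - (X *m bs + e)) ^+ 2 + 2 * (C * l1norm b)) bh ->
  c * (\sum_k \sum_l col (block k (J k)) X l 0 * e l 0) - C * (c * d%:R) <=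
    l2norm (X *m (bh - bs)).
Proof.
move=> cE bh_min; pose S := [set block k (J k) | k : 'I_d]%SET.
have cS : #|S| = d by exact: card_block.
have [[ric0 ricH] _] := ric_is_min X d.
have sn : 0 < Num.sqrt (n%:R : R) by rewrite sqrtr_gt0 ltr0n.
have sd : 0 < Num.sqrt (d%:R : R) by rewrite sqrtr_gt0 ltr0n.
have r0 : 0 < 1 + ric X d by rewrite ltr_pwDl.
have c0 : 0 < c by rewrite cE invr_gt0 !mulr_gt0.
pose b : 'cV[R]_p := indicator_col S.
(* The indicator [b] is [d]-sparse of norm [sqrt d], so that [|X b| <= sqrt n (1 + ric X d) sqrt d =
   1 / c]. *)
have /andP[_ Xb] : (1 - ric X d) * l2norm b <= (Num.sqrt n%:R)^-1 * l2norm (X *m b)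
      <= (1 + ric X d) * l2norm b.
  by apply: ricH; rewrite l0norm_indicator cS.
have /noise_barrier : l2norm (X *m (c *: b)) <= 1.
  rewrite -scalemxAr l2normZ ?(ltW c0)// cE ler_pdivrMl ?mulr_gt0// mulr1.
  move: Xb; rewrite ler_pdivrMl// l2norm_indicator cS => /le_trans; apply.
  by rewrite le_eqVlt; apply/orP; left; apply/eqP; ring.
move=> /(_ e bs bh bh_min); apply: le_trans.
have -> : l1norm (c *: b) = c * d%:R.
  rewrite -cS -(l1norm_indicator (R := R)) /l1norm mulr_sumr.
  by apply: eq_bigr => i _; rewrite mxE normrM gtr0_norm.
rewrite lerD2r le_eqVlt; apply/orP; left; apply/eqP.
rewrite exchange_big mulr_sumr; apply: eq_bigr => i _ /=.
rewrite -scalemxAr mxE mulmx_indicator big_imset/=; last first.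
  by move=> k k' _ _ /block_inj[].
rewrite mulrCA; congr (_ * _); rewrite mulr_sumr.
by apply: eq_bigr => k _; rewrite mxE mulrC.
Qed.

End noise_barrier.

(** * Assembly of the block estimates and the constants *)

Theorem theorem4p5 (R : realType) (disp : measure_display)
    (T : measurableType disp) (P : probability T R)
    (n p : nat) (hn : (0 < n)%N)
    (X : 'M[R]_(n, p)) (beta_star : 'cV[R]_p)
    (sigma : R) (hsigma : 0 < sigma)
    (eps : T -> 'cV[R]_n) (heps : isotropic_gaussian P eps sigma)
    (y : T -> 'cV[R]_n) (hy : forall w, y w = X *m beta_star + eps w)
    (lambda : R) (hlambda : 0 <= lambda)
    (h : 'cV[R]_p -> R)
    (hh : forall b, h b = Num.sqrt n%:R * lambda * l1norm b)
    (beta_hat : T -> 'cV[R]_p)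
    (hbeta_hat : forall w,
      argmin (fun b => l2norm (X *m b - y w) ^+ 2 + 2 * h b) (beta_hat w))
    (d : nat) (hd : (1 <= d)%N) (hdp : (5 * d <= p)%N)
    (htuning : lambda <= (1 - ric X (2 * d)) / 8
                 * sigma * Num.sqrt (ln (p%:R / (5 * d)%:R))) :
  (((1 - ric X (2 * d)) / (8 * (1 + ric X d))
      * sigma * Num.sqrt (d%:R * ln (p%:R / (5 * d)%:R)))%:E
    <= 'E_P[fun w => l2norm (X *m (beta_hat w - beta_star))])%E.
Proof.
have d0 : (0 : R) < d%:R by rewrite ltr0n.
have p0 : (0 < p)%N by rewrite (leq_trans _ hdp)// muln_gt0 hd.
have [[ric0 _] _] := ric_is_min X d.
have r0 : 0 < 1 + ric X d by rewrite ltr_pwDl.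
have E0 : (0 <= 'E_P[fun w => l2norm (X *m (beta_hat w - beta_star))])%E.
  by apply: expectation_ge0 => w; exact: l2norm_ge0.
set K := ln (p%:R / (5 * d)%:R) in htuning *.
set delta := ric X (2 * d) in htuning *.
set rho := ric X d in r0 ric0 *.
(* If [delta >= 1] the claimed lower bound is at most 0. *)
have [dl|dl] := leP (1 - delta) 0.
  apply: le_trans E0; rewrite lee_fin -mulrA mulr_le0_ge0//.
    by rewrite mulr_le0_ge0// invr_ge0 mulr_ge0// ltW.
  by rewrite mulr_ge0 ?sqrtr_ge0// ltW.
pose q := (p %/ d)%N.
have q5 : (5 <= q)%N by rewrite leq_divRL.
have q0 : (0 < q)%N by exact: leq_trans q5.
pose C := Num.sqrt n%:R * lambda.
have C0 : 0 <= C by rewrite mulr_ge0 ?sqrtr_ge0.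
pose v (k : 'I_d) (j : 'I_q) := col (block k j) X.
pose G k j w := gauss_proc eps (v k) j w.
pose M k w := \big[Num.max/G k (Ordinal q0) w]_j G k j w.
(* The separation of two columns given by [ric_col_dist] with [s = 2 * d]. *)
pose a := Num.sqrt n%:R * ((1 - delta) * Num.sqrt 2) : R.
have a0 : 0 <= a by rewrite mulr_ge0 ?sqrtr_ge0// mulr_ge0 ?sqrtr_ge0// ltW.
have iM k : P.-integrable setT (EFin \o M k).
  apply: integrable_bigmax => j.
  exact: (integrable_gauss_proc hsigma heps).
have sep k (i j : 'I_q) : i != j -> a <= l2norm (v k i - v k j).
  move=> ij; apply: ric_col_dist => //; first by rewrite leq_pmulr.
  by apply: contra_neq ij => /block_inj[].
have EM k : ((sigma * a / Num.sqrt 8 * Num.sqrt (ln (q%:R / 4)))%:E <=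
    \int[P]_w (M k w)%:E)%E.
  apply: (sudakov_minoration hsigma heps q0 (sep k) a0 (iM k)) => j w.
  exact: le_bigmax.
pose c := (Num.sqrt n%:R * Num.sqrt d%:R * (1 + rho))^-1 : R.
have sn : 0 < Num.sqrt (n%:R : R) by rewrite sqrtr_gt0 ltr0n.
have sd : 0 < Num.sqrt (d%:R : R) by rewrite sqrtr_gt0.
have c0 : 0 < c by rewrite invr_gt0 !mulr_gt0.
pose g w := c * (\sum_k M k w) - C * (c * d%:R).
have gf w : g w <= l2norm (X *m (beta_hat w - beta_star)).
  (* [J] picks in each block the column that attains the maximum at the sample point [w]. *)
  have [J HJ] := choice (fun k => bigmax_attained (Ordinal q0) (G k ^~ w)).
  have bh_min : argmin (fun b => l2norm (X *m b - (X *m beta_star + eps w)) ^+ 2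
      + 2 * (C * l1norm b)) (beta_hat w).
    by move=> b; have := hbeta_hat w b; rewrite !hh hy.
  have := noise_barrier_blocks C0 hd hn J erefl bh_min.
  apply: le_trans; rewrite /g lerD2r ler_wpM2l ?(ltW c0)// ler_sum// => k _.
  by rewrite /M HJ.
have iM' : P.-integrable setT (fun w => \sum_k (M k w)%:E)%E.
  apply: (@integrable_sum _ _ _ P setT measurableT _ _ predT
    (fun k w => (M k w)%:E)) => k _; exact: iM.
have iMsum : P.-integrable setT (fun w => c%:E * (\sum_k (M k w)%:E)%E)%E.
  exact: integrableZl.
have icst : P.-integrable setT (fun=> (C * (c * d%:R))%:E).
  exact: (@finite_measure_integrable_cst _ _ _ P).
have gE w : (g w)%:E = (c%:E * (\sum_k (M k w)%:E)%E - (C * (c * d%:R))%:E)%E.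
  by rewrite /g sumEFin.
have ig : P.-integrable setT (EFin \o g).
  rewrite [X in _.-integrable _ X](_ : _ = (fun w => c%:E * (\sum_k (M k w)%:E)%E)
      \- (fun=> (C * (c * d%:R))%:E))%E; last by apply/funext => w; exact: gE.
  exact: integrableB.
pose b := sigma * a / Num.sqrt 8 * Num.sqrt (ln (q%:R / 4)).
have Eg : ((c * (d%:R * b) - C * (c * d%:R))%:E <= \int[P]_w (g w)%:E)%E.
  under eq_integral do rewrite gE.
  rewrite (integralB measurableT iMsum icst) integralZl//.
  rewrite integral_sum//.
  have -> : (\int[P]_w (C * (c * d%:R))%:E = (C * (c * d%:R))%:E)%E.
    by have := expectation_cst P (C * (c * d%:R)); rewrite unlock.
  rewrite EFinB leeB// EFinM lee_wpmul2l ?lee_fin ?(ltW c0)//.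
  have -> : (d%:R * b)%:E = (\sum_(k < d) b%:E)%E.
    by rewrite sumEFin sumr_const card_ord mulr_natl.
  exact: lee_sum.
rewrite unlock; apply: le_trans (le_integral_nonmeasurable ig _ gf); last first.
  by move=> w; exact: l2norm_ge0.
apply: le_trans Eg; rewrite lee_fin.
have K_le : Num.sqrt K <= Num.sqrt (ln (q%:R / 4)).
  rewrite ler_wsqrtr// ler_ln ?posrE ?divr_gt0 ?ltr0n ?muln_gt0 ?p0//.
  rewrite ler_pdivrMr ?ltr0n ?muln_gt0// mulrAC ler_pdivlMr// -!natrM ler_nat.
  exact: block_size_ge.
have s8 : Num.sqrt 8 = 2 * Num.sqrt 2 :> R.
  rewrite (_ : 8 = 2 ^+ 2 * 2 :> R); last by ring.
  by rewrite sqrtrM ?sqr_ge0// sqrtr_sqr ger0_norm.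
have s2 : Num.sqrt 2 != 0 :> R by rewrite gt_eqF// sqrtr_gt0.
have dd : d%:R = Num.sqrt d%:R ^+ 2 :> R by rewrite sqr_sqrtr// ltW.
have bE : b = Num.sqrt n%:R * (sigma * (1 - delta) / 2 * Num.sqrt (ln (q%:R / 4))).
  by rewrite /b /a s8; field.
(* The factor [1 / 2] is [sqrt 2 / sqrt 8], and [c d = sqrt d / ((1 + rho) sqrt n)] cancels the
   [sqrt n] of both [b] and [C]. *)
have -> : c * (d%:R * b) - C * (c * d%:R) = Num.sqrt d%:R / (1 + rho) *
    (sigma * (1 - delta) / 2 * Num.sqrt (ln (q%:R / 4)) - lambda).
  have cd : c * d%:R = Num.sqrt d%:R / (1 + rho) / Num.sqrt n%:R.
    by rewrite /c [X in _ * X = _]dd; field; rewrite !gt_eqF.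
  transitivity (c * d%:R * (b - C)); first by ring.
  by rewrite cd bE /C; field; rewrite !gt_eqF.
rewrite (sqrtrM _ (ltW d0)).
have -> : (1 - delta) / (8 * (1 + rho)) * sigma * (Num.sqrt d%:R * Num.sqrt K) =
    Num.sqrt d%:R / (1 + rho) * (sigma * (1 - delta) / 8 * Num.sqrt K).
  by field; rewrite gt_eqF.
rewrite ler_wpM2l ?divr_ge0 ?(ltW sd) ?(ltW r0)//.
have sK := sqrtr_ge0 K.
have sd0 : 0 <= sigma * (1 - delta) by rewrite mulr_ge0 ?(ltW hsigma) ?(ltW dl).
have := ler_wpM2l sd0 K_le; have := mulr_ge0 sd0 sK.
move: htuning.
rewrite (_ : (1 - delta) / 8 * sigma = sigma * (1 - delta) / 8); last by ring.
(* Of the coefficient [1/2], at most [1/8] is spent on [lambda]; the remaining [3/8] exceeds the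
   claimed [1/8]. *)
move: (sigma * (1 - delta)) (Num.sqrt K) (Num.sqrt _) => A B D; nra.
Qed.
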